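(* Let $\mathcal A$ be a deterministic, uniquely represented streaming algorithm maintaining a signed multiset over a finite set $S$, with associated map $u:M\to$ states. For states $a,b$ in the image of $u$, define $a+b=u(A+B)$ where $A,B\in M$ are any signed multisets with $u(A)=a$, $u(B)=b$. Then this operation is well-defined (independent of the choice of $A$ and $B$), the states $u(M)$ form a commutative group under it, and $u$ is a group homomorphism from $M$ onto this group.
   Context: A signed multiset over a finite set $S$ is a map $f:S\to\mathbb Z$. Inserting $x$ increases $f(x)$ by one; deleting $x$ decreases $f(x)$ by one, so any sequence of insertions and deletions starting from the empty multiset produces a well-defined signed multiset, and every signed multiset arises this way. The signed multisets form a commutative group $M\cong\mathbb Z^{|S|}$ under pointwise addition. A deterministic streaming algorithm maintaining a signed multiset has a fixed initial state and processes insert/delete operations one at a time, each operation deterministically transforming the current state. It is uniquely represented if there is a map $u$ from $M$ to states such that after any sequence of updates producing multiset $A$ (regardless of order) the state is $u(A)$. *)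

(* Defs.v *)
From HB Require Import structures.
From mathcomp Require Import all_boot all_order all_algebra.
From mathcomp Require Import boolp classical_sets.

Set Implicit Arguments.
Unset Strict Implicit.
Unset Printing Implicit Defensive.

Import GRing.Theory.
Local Open Scope classical_set_scope.
Local Open Scope ring_scope.

(* {ffun S -> int} carries the pointwise zmodType structure. *)
Notation signed_multiset S := {ffun S -> int}.

Variant update (S : Type) : Type := Insert of S | Delete of S.

Definition apply_update (S : finType) (f : signed_multiset S) (o : update S) :
    signed_multiset S :=
  match o with
  | Insert x => [ffun y => if y == x then f y + 1 else f y]
  | Delete x => [ffun y => if y == x then f y - 1 else f y]
  end.

Definition multiset_of (S : finType) (ops : seq (update S)) : signed_multiset S :=
  foldl (@apply_update S) 0 ops.

Record streaming_algorithm (S : Type) : Type := StreamingAlgorithm {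
  state : Type;
  init : state;
  step : state -> update S -> state
}.

Definition run (S : Type) (Alg : streaming_algorithm S) (ops : seq (update S)) :
    state Alg :=
  foldl (@step S Alg) (init Alg) ops.

Definition uniquely_represented_by (S : finType) (Alg : streaming_algorithm S)
    (u : signed_multiset S -> state Alg) : Prop :=
  forall (A : signed_multiset S) (ops : seq (update S)),
    multiset_of ops = A -> run Alg ops = u A.

Definition commutative_group (G : Type) (op : G -> G -> G) : Prop :=
  [/\ associative op, commutative op &
      exists (e : G) (inv : G -> G), left_id e op /\ left_inverse e inv op].

(* u with its codomain restricted to its image. *)
Definition to_range (T U : Type) (u : T -> U) (x : T) : range u :=
  exist _ (u x) (mem_set (imageT u x)).

(* Main.v *)
(** Every signed multiset is produced by some update sequence [ops], and feeding
    [ops] to the algorithm from state [u A] leads to [u (A + multiset_of ops)].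
    So [u (A + B)] depends on [A] only through [u A]; by commutativity it depends
    on [B] only through [u B], i.e. the fibres of [u] form a congruence on the
    group of signed multisets and [range u] is the quotient group. *)

Require Import Defs.
From HB Require Import structures.
From mathcomp Require Import all_boot all_order all_algebra.
From mathcomp Require Import boolp classical_sets.

Set Implicit Arguments.
Unset Strict Implicit.
Unset Printing Implicit Defensive.

Import GRing.Theory.
Local Open Scope classical_set_scope.
Local Open Scope ring_scope.

Section UpdateSequences.
Variable S : finType.
Implicit Types (A B f : signed_multiset S) (ops : seq (update S)).

(** An update is a translation by a vector independent of the current multiset, so a sequence acts
    by the sum of its translations. *)
Lemma apply_updateE f (o : update S) :
  apply_update f o = f + apply_update 0 o.
Proof.
by apply/ffunP => y; case: o => x /=; rewrite !ffunE; case: eqP;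
  rewrite ?add0r ?addr0.
Qed.

Lemma foldl_apply_update f ops :
  foldl (@apply_update S) f ops = f + multiset_of ops.
Proof.
rewrite /multiset_of; elim: ops f => [|o ops IH] f /=; first by rewrite addr0.
by rewrite IH (IH (apply_update 0 o)) apply_updateE addrA.
Qed.

Lemma multiset_of_cat ops1 ops2 :
  multiset_of (ops1 ++ ops2) = multiset_of ops1 + multiset_of ops2.
Proof. by rewrite {1}/multiset_of foldl_cat foldl_apply_update. Qed.

Lemma multiset_of_nseq n (o : update S) :
  multiset_of (nseq n o) = apply_update 0 o *+ n.
Proof.
elim: n => [|n IH] //.
by rewrite -[nseq _ _]/([:: o] ++ nseq n o) multiset_of_cat IH mulrS.
Qed.

(** The indicators [apply_update 0 (Insert x)] generate the group; concatenation realises sums, and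
    repeated insertions or deletions realise integer multiples. *)
Lemma multiset_of_surj A : exists ops, multiset_of ops = A.
Proof.
have -> : A = \sum_x apply_update 0 (Insert x) *~ A x.
  apply/ffunP => y; rewrite sum_ffunE (bigD1 y) //= big1 => [|x xy].
    by rewrite ffunMzE !ffunE eqxx add0r addr0 intz.
  by rewrite ffunMzE !ffunE eq_sym (negPf xy) mul0rz.
apply: (big_ind (fun B => exists ops, multiset_of ops = B)).
- by exists [::].
- by move=> _ _ [ops1 <-] [ops2 <-]; exists (ops1 ++ ops2); apply: multiset_of_cat.
move=> x _; case: (A x) => n.
  by exists (nseq n (Insert x)); apply: multiset_of_nseq.
(* [Negz n] stands for [-(n + 1)], hence [n.+1] deletions. *)
exists (nseq n.+1 (Delete x)); rewrite multiset_of_nseq NegzE mulrNz -mulNrn.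
congr (_ *+ _); apply/ffunP => y; rewrite !ffunE.
by case: eqP; rewrite ?add0r ?oppr0.
Qed.

Variables (Alg : streaming_algorithm S) (u : signed_multiset S -> state Alg).
Hypothesis hu : uniquely_represented_by u.

(** [u A] is the state after any sequence producing [A], so continuing with [ops] is a run on a
    concatenation. *)
Lemma uniquely_represented_step A ops :
  foldl (@step S Alg) (u A) ops = u (A + multiset_of ops).
Proof.
have [opsA <-] := multiset_of_surj A.
by rewrite -(hu erefl) -multiset_of_cat -(hu erefl) /run foldl_cat.
Qed.

Lemma uniquely_represented_addl A A' B : u A = u A' -> u (A + B) = u (A' + B).
Proof.
have [ops <-] := multiset_of_surj B.
by rewrite -!uniquely_represented_step => ->.
Qed.

Lemma uniquely_represented_add A A' B B' :
  u A = u A' -> u B = u B' -> u (A + B) = u (A' + B').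
Proof.
move=> uA uB; rewrite (uniquely_represented_addl B uA) addrC [in RHS]addrC.
exact: uniquely_represented_addl.
Qed.

End UpdateSequences.

Lemma to_range_surj (T U : Type) (u : T -> U) (a : range u) :
  exists x, to_range u x = a.
Proof.
by case: a => y yu; have [x _ uxy] := set_mem yu; exists x; apply: val_inj.
Qed.

Theorem lemma2 (S : finType) (Alg : streaming_algorithm S)
    (u : signed_multiset S -> state Alg)
    (hu : uniquely_represented_by u) :
  (forall A A' B B' : signed_multiset S,
      u A = u A' -> u B = u B' -> u (A + B) = u (A' + B')) /\
  (exists add : range u -> range u -> range u,
    [/\ forall (a b : range u) (A B : signed_multiset S),
          u A = val a -> u B = val b -> val (add a b) = u (A + B),
        commutative_group add,
        {morph to_range u : A B / A + B >-> add A B} &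
        forall a : range u, exists A : signed_multiset S, to_range u A = a]).
Proof.
have u_add := uniquely_represented_add hu; split=> //.
(* A section of [to_range u] gives the operation on states as a function; [u_add] makes the choice
   of representatives immaterial. *)
have [rep repK] := choice (@to_range_surj _ _ u).
have u_rep a : u (rep a) = val a by rewrite -[in RHS](repK a).
pose add a b := to_range u (rep a + rep b).
have addE A B : add (to_range u A) (to_range u B) = to_range u (A + B).
  by apply: val_inj; apply: u_add; rewrite u_rep.
exists add; split=> //; last exact: to_range_surj.
- by move=> a b A B uA uB; apply: u_add; rewrite u_rep.
split.
(* Every element of the range is some [to_range u A], so [addE] transfers each law from signed
   multisets. *)
- by move=> a b c; rewrite -(repK a) -(repK b) -(repK c) !addE addrA.
- by move=> a b; rewrite -(repK a) -(repK b) !addE addrC.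
exists (to_range u 0), (fun a => to_range u (- rep a)); split=> a.
  by rewrite -(repK a) addE add0r.
(* Only the summand [a] is replaced, so that [- rep a] and [rep a] cancel. *)
by rewrite -{2}(repK a) addE addNr.
Qed.
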